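(* Let $R$ be a ring and let $S\subseteq R$ be an Ore set consisting of regular elements of $R$. Let $Q$ be the left quotient ring of $R$ with respect to $S$. Then the following are equivalent: (1) $R$ is right endo-Noetherian; (2) $Q$ is right endo-Noetherian.
   Context: All rings are associative with identity, not necessarily commutative. For a ring $A$ and $a\in A$, the right annihilator is $r.\mathrm{ann}_A(a)=\{b\in A: ab=0\}$. A ring $A$ is called right endo-Noetherian if for every sequence $(a_i)_{i\in\mathbb N}$ of elements of $A$ with $r.\mathrm{ann}_A(a_1)\subseteq r.\mathrm{ann}_A(a_2)\subseteq\cdots$, there is a positive integer $n$ with $r.\mathrm{ann}_A(a_k)=r.\mathrm{ann}_A(a_n)$ for all $k\ge n$. An element is regular if it is neither a left nor a right zero divisor. A multiplicatively closed subset $S$ of $R$ (containing $1$) is an Ore set if it is both a right Ore set (for all $r\in R$, $s\in S$ there exist $r'\in R$, $s'\in S$ with $rs'=sr'$) and a left Ore set (for all $r\in R$, $s\in S$ there exist $r'\in R$, $s'\in S$ with $s'r=r's$). The left quotient ring $Q$ of $R$ with respect to $S$ is the ring containing $R$ as a subring in which every element of $S$ is invertible and every element has the form $s^{-1}r$ with $r\in R$, $s\in S$. *)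

(* Defs.v *)
From HB Require Import structures.
From mathcomp Require Import all_boot all_order all_algebra.
From mathcomp Require Import boolp classical_sets.

Set Implicit Arguments.
Unset Strict Implicit.
Unset Printing Implicit Defensive.

Import GRing.Theory.
Local Open Scope ring_scope.
Local Open Scope classical_set_scope.

(* [pzRingType] (rather than [nzRingType]) is the class of all associative
   unital rings, the zero ring included. *)

Definition rann (A : pzRingType) (a : A) : set A := [set b | a * b = 0].

(* Sequences are indexed from 0: [a i] is the (i+1)-st term. *)
Definition right_endo_noetherian (A : pzRingType) : Prop :=
  forall a : nat -> A,
    (forall i, rann (a i) `<=` rann (a i.+1)) ->
    exists n : nat, forall k : nat, (n <= k)%N -> rann (a k) = rann (a n).

Definition left_zero_divisor (A : pzRingType) (a : A) : Prop :=
  exists b : A, b <> 0 /\ a * b = 0.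

Definition right_zero_divisor (A : pzRingType) (a : A) : Prop :=
  exists b : A, b <> 0 /\ b * a = 0.

Definition regular_elt (A : pzRingType) (a : A) : Prop :=
  ~ left_zero_divisor a /\ ~ right_zero_divisor a.

Definition mult_closed (R : pzRingType) (S : set R) : Prop :=
  S 1 /\ (forall s t, S s -> S t -> S (s * t)).

Definition right_ore (R : pzRingType) (S : set R) : Prop :=
  forall r s, S s -> exists r' s', S s' /\ r * s' = s * r'.

Definition left_ore (R : pzRingType) (S : set R) : Prop :=
  forall r s, S s -> exists r' s', S s' /\ s' * r = r' * s.

Definition ore_set (R : pzRingType) (S : set R) : Prop :=
  [/\ mult_closed S, right_ore S & left_ore S].

(* A [pzRingType] carries no inverse operation, so the inverse is relational. *)
Definition inverse_of (A : pzRingType) (x y : A) : Prop :=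
  x * y = 1 /\ y * x = 1.

(* The embedding of R as a subring of Q is the injective morphism [iota]; the
   witness [t] of the last clause is the inverse of [iota s]. *)
Definition left_quotient_ring (R : pzRingType) (S : set R)
    (Q : pzRingType) (iota : {rmorphism R -> Q}) : Prop :=
  [/\ injective iota,
      forall s, S s -> exists t, inverse_of (iota s) t
    & forall q : Q, exists r s t,
        [/\ S s, inverse_of (iota s) t & q = t * iota r]].

(* Main.v *)
Require Import Defs.
From mathcomp Require Import all_boot all_order all_algebra.
From mathcomp Require Import boolp classical_sets.

(* By the right Ore condition every element of Q is also a right fraction
   r s^-1, so an inclusion between the right annihilators of two elements of R
   holds in R iff it holds in Q.  Since s^-1 r and r have the same right
   annihilator in Q, chains of right annihilators in R and in Q correspond. *)

Import GRing.Theory.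
Local Open Scope ring_scope.
Local Open Scope classical_set_scope.

(** Left multiplication by [t] is injective, since [s] undoes it. *)
Lemma rann_inverse_mul (A : pzRingType) (s t a : A) :
  inverse_of s t -> rann (t * a) = rann a.
Proof.
move=> [st _]; apply/seteqP; split=> b; rewrite /rann /=.
  by move=> tab; rewrite -[a]mul1r -st -2!mulrA [t * _]mulrA tab mulr0.
by move=> ab; rewrite -mulrA ab mulr0.
Qed.

Lemma right_fraction (R : pzRingType) (S : set R) (Q : pzRingType)
    (iota : {rmorphism R -> Q}) (q : Q) :
  right_ore S -> left_quotient_ring S iota ->
  exists r s t, [/\ S s, inverse_of (iota s) t & q = iota r * t].
Proof.
move=> ore [_ inv /(_ q)[r [s [t [Ss [_ ts] ->]]]]].
(* The Ore identity [r * s' = s * r'] becomes s^-1 r = r' s'^-1 in [Q]. *)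
have [r' [s' [Ss' rs']]] := ore r s Ss; have [t' [st' ts']] := inv s' Ss'.
exists r', s', t'; split=> //.
rewrite -[LHS]mulr1 -st' -mulrA [iota r * _]mulrA -rmorphM rs' rmorphM.
by rewrite !mulrA ts mul1r.
Qed.

Lemma rann_iota_subset (R : pzRingType) (S : set R) (Q : pzRingType)
    (iota : {rmorphism R -> Q}) (a b : R) :
  right_ore S -> left_quotient_ring S iota ->
  rann (iota a) `<=` rann (iota b) <-> rann a `<=` rann b.
Proof.
move=> ore hQ; have [inj _ _] := hQ; split=> sub c; rewrite /rann /= => ac.
  by apply: inj; rewrite rmorphM rmorph0; apply: sub; rewrite /rann /= -rmorphM ac rmorph0.
have [r [s [t [_ [st ts] def_c]]]] := right_fraction _ _ _ _ c ore hQ.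
(* As the denominator of [c] stands on its right, multiplying the equation [ac] by [iota s] on the
   right clears it, and injectivity of [iota] brings the result back to [R]. *)
have ar : a * r = 0.
  by apply: inj; rewrite rmorphM rmorph0 -[iota r]mulr1 -ts [iota r * _]mulrA -def_c
    mulrA ac mul0r.
by rewrite def_c mulrA -rmorphM (sub r ar) rmorph0 mul0r.
Qed.

Theorem theorem1 (R : pzRingType) (S : set R)
    (hOre : ore_set S) (hreg : forall s : R, S s -> regular_elt s)
    (Q : pzRingType) (iota : {rmorphism R -> Q})
    (hQ : left_quotient_ring S iota) :
  right_endo_noetherian R <-> right_endo_noetherian Q.
Proof.
have [_ ore _] := hOre.
have subE a b := rann_iota_subset _ _ _ _ a b ore hQ.
have eqE a b : rann (iota a) = rann (iota b) <-> rann a = rann b.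
  by split=> /seteqP[ab ba]; apply/seteqP; split; apply/subE.
split=> noeth a chain.
  (* Each term of a chain in [Q] may be replaced by the numerator of a left fraction for it. *)
  have num i : exists r, rann (a i) = rann (iota r).
    have [_ _ /(_ (a i))[r [s [t [_ st ->]]]]] := hQ.
    by exists r; apply: rann_inverse_mul st.
  have [r ra] := choice num.
  have [|n stab] := noeth r; first by move=> i; apply/subE; rewrite -!ra.
  by exists n => k nk; rewrite !ra; apply/eqE/stab.
(* Conversely, a chain in [R] is carried to [Q] by [iota]. *)
have [|n stab] := noeth (iota \o a); first by move=> i; apply/subE.
by exists n => k nk; apply/eqE/stab.
Qed.
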